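(* Let $R$ be an integral domain which is not a field. Let $O(R)$ be the set of all overrings of $R$ and $O_t(R)$ the set of all $t$-linked overrings of $R$. If $O_t(R)$ is finite, then $O(R)=O_t(R)$, and therefore $R$ is an FO-domain.
   Context: Let $L$ be the quotient field of $R$. An overring of $R$ is a ring $T$ with $R\subseteq T\subseteq L$. For an ideal $I$ of $R$, $I^{-1}=(R:I)=\{x\in L : xI\subseteq R\}$, and for an overring $T$, $(T:IT)=\{x\in L: xIT\subseteq T\}$. An overring $T$ of $R$ is $t$-linked over $R$ if, for each finitely generated ideal $I$ of $R$, $I^{-1}=R$ implies $(T:IT)=T$. $R$ is an FO-domain if it has only finitely many overrings. *)

(* Defs.v *)
From HB Require Import structures.
From mathcomp Require Import all_boot all_order all_algebra.
From mathcomp Require Import boolp classical_sets cardinality.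

Set Implicit Arguments.
Unset Strict Implicit.
Unset Printing Implicit Defensive.

Import GRing.Theory.
Local Open Scope classical_set_scope.
Local Open Scope ring_scope.

(* The copy of R inside its quotient field L = {fraction R}. *)
Definition base_ring (R : idomainType) : set {fraction R} := range (@tofrac R).
Arguments base_ring R : clear implicits.

Definition is_overring (R : idomainType) (T : set {fraction R}) : Prop :=
  GRing.subring_closed (mem T) /\ base_ring R `<=` T.

Definition fg_ideal (R : idomainType) (I : set R) : Prop :=
  exists (n : nat) (g : 'I_n -> R),
    I = [set x | exists c : 'I_n -> R, x = \sum_(i < n) c i * g i].

(* (A : B), computed inside L. *)
Definition colon (R : idomainType) (A B : set {fraction R}) : set {fraction R} :=
  [set x | forall b, B b -> A (x * b)].

Definition ideal_inv (R : idomainType) (I : set R) : set {fraction R} :=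
  colon (base_ring R) (@tofrac R @` I).

(* The extended ideal IT: all finite sums of products a t with a in I, t in T. *)
Definition ideal_ext (R : idomainType) (I : set R) (T : set {fraction R}) :
    set {fraction R} :=
  [set x | exists (n : nat) (a : 'I_n -> R) (t : 'I_n -> {fraction R}),
     [/\ forall i, I (a i), forall i, T (t i)
       & x = \sum_(i < n) tofrac (a i) * t i]].

Definition t_linked (R : idomainType) (T : set {fraction R}) : Prop :=
  forall I : set R, fg_ideal I ->
    ideal_inv I = base_ring R -> colon T (ideal_ext I T) = T.

Definition overrings (R : idomainType) : set (set {fraction R}) :=
  [set T | is_overring T].

Definition t_linked_overrings (R : idomainType) : set (set {fraction R}) :=
  [set T | is_overring T /\ t_linked T].

Arguments overrings R : clear implicits.
Arguments t_linked_overrings R : clear implicits.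

Definition FO_domain (R : idomainType) : Prop := finite_set (overrings R).

(* Main.v *)
(** Every R[1/f] is a t-linked overring, so there are only finitely many of
    them.  This forces each nonzero ideal I to contain some f whose radical
    contains I: if nonzero f in I has R[1/f] minimal and some
    element of I is not in the radical of (f), pick such a c with R[1/c] maximal
    and put g = f + c.  Since cg is not in the radical of (f) either,
    R[1/c] = R[1/cg], so c, hence f, is in the radical of (g); minimality of
    R[1/f] then puts g, hence c, in the radical of (f), which is absurd.
    If moreover I is finitely generated and I^-1 = R, then 1/f multiplies a power
    of I into R, so f is a unit and I = R; hence every overring is t-linked. *)

Require Import Defs.
From mathcomp Require Import all_boot all_order all_algebra.
From mathcomp Require Import boolp classical_sets cardinality.

Set Implicit Arguments.
Unset Strict Implicit.
Unset Printing Implicit Defensive.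

Import GRing.Theory.
Local Open Scope classical_set_scope.
Local Open Scope ring_scope.

(** [mu x] counts the entries of a list enumerating [A] that are contained in [F x]. When [F x] is
    strictly smaller than [F y], the entry [F y] is counted for [y] but not for [x]. Numbers can
    thus replace inclusions in minimal and maximal choices. *)
Lemma finite_set_rank (X U : Type) (A : set (set U)) (F : X -> set U) :
    finite_set A -> (forall x, A (F x)) ->
  exists (mu : X -> nat) (N : nat),
    [/\ forall x, (mu x <= N)%N
      , forall x y, F x `<=` F y -> (mu x <= mu y)%N
      & forall x y, F x `<=` F y -> (mu y <= mu x)%N -> F y `<=` F x].
Proof.
move=> /finite_seqP[s sA] AF.
pose mu x := count (fun B : set U => `[< B `<=` F x >]) s.
exists mu, (size s); split=> [x|x y xy|x y xy].
- exact: count_size.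
- by apply: sub_count => B /asboolP Bx; apply/asboolP; apply: subset_trans xy.
apply: contraPP => yx; apply/negP; rewrite -ltnNge /mu.
have sFy : F y \in s by have := AF y; rewrite sA.
have [s1 [s2 ->]] : exists s1 s2, s = s1 ++ F y :: s2.
  by case/splitPr: sFy => s1 s2; exists s1, s2.
rewrite !count_cat /= (asboolF yx) asboolT // add0n addnCA add1n ltnS.
by apply: leq_add; apply: sub_count => B /asboolP Bx; apply/asboolP;
  apply: subset_trans xy.
Qed.

Lemma ex_nat_min (X : Type) (P : X -> Prop) (mu : X -> nat) :
  (exists x, P x) -> exists2 x, P x & forall y, P y -> (mu x <= mu y)%N.
Proof.
move=> [x0 Px0].
have exn : exists n, `[< exists2 x, P x & mu x = n >].
  by exists (mu x0); apply/asboolP; exists x0.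
case: (ex_minnP exn) => n /asboolP[x Px <-] min_n.
by exists x => // y Py; apply: min_n; apply/asboolP; exists y.
Qed.

Lemma ex_nat_max (X : Type) (P : X -> Prop) (mu : X -> nat) (N : nat) :
    (forall x, (mu x <= N)%N) -> (exists x, P x) ->
  exists2 x, P x & forall y, P y -> (mu y <= mu x)%N.
Proof.
move=> muN /(@ex_nat_min X P (fun x => N - mu x)%N)[x Px xmin].
by exists x => // y /xmin; rewrite leq_sub2lE.
Qed.

(** * Radicals of principal ideals *)

Definition in_radical (R : idomainType) (f a : R) : Prop :=
  exists n h, a ^+ n = f * h.

(** The difference of [(a + f * k) ^+ n] and [a ^+ n] is a multiple of [f * k]. *)
Lemma in_radicalD (R : idomainType) (f a k : R) :
  in_radical f a -> in_radical f (a + f * k).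
Proof.
move=> [n [h anE]].
exists n, (h + k * \sum_(i < n) (a + f * k) ^+ (n.-1 - i) * a ^+ i).
have /eqP := subrXX (a + f * k) a n; rewrite subr_eq addrAC subrr add0r => /eqP.
by move=> ->; rewrite anE addrC mulrDr mulrA.
Qed.

Lemma in_radicalN (R : idomainType) (f a : R) :
  in_radical f a -> in_radical f (- a).
Proof.
move=> [n [h anE]]; exists n, ((-1) ^+ n * h).
by rewrite [LHS]exprNn anE mulrCA.
Qed.

(** * Overrings and localizations at one element *)

Section Overrings.
Variable R : idomainType.
Implicit Types (f g : R) (I : set R) (T : set {fraction R}).

Lemma is_overringP T : is_overring T <->
  [/\ base_ring R `<=` T, forall x y, T x -> T y -> T (x - y)
    & forall x y, T x -> T y -> T (x * y)].
Proof.
split=> [[[_ TB TM] RT]|[RT TB TM]]; split=> //.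
- by move=> x y Tx Ty; apply: set_mem; apply: TB; apply: mem_set.
- by move=> x y Tx Ty; apply: set_mem; apply: TM; apply: mem_set.
split.
- by apply: mem_set; apply: RT; exists 1; rewrite ?rmorph1.
- by move=> x y /set_mem Tx /set_mem Ty; apply: mem_set; apply: TB.
- by move=> x y /set_mem Tx /set_mem Ty; apply: mem_set; apply: TM.
Qed.

Lemma base_ring_tofrac (a : R) : base_ring R (tofrac a).
Proof. by exists a. Qed.

Lemma base_ringM x y : base_ring R x -> base_ring R y -> base_ring R (x * y).
Proof. by move=> [a _ <-] [b _ <-]; exists (a * b); rewrite ?rmorphM. Qed.

Lemma base_ringB x y : base_ring R x -> base_ring R y -> base_ring R (x - y).
Proof. by move=> [a _ <-] [b _ <-]; exists (a - b); rewrite ?rmorphB. Qed.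

Lemma overring_sum T (n : nat) (t : 'I_n -> {fraction R}) :
  is_overring T -> (forall i, T (t i)) -> T (\sum_(i < n) t i).
Proof.
move=> /is_overringP[RT TB _] Tt.
have T0 : T 0 by apply: RT; exists 0; rewrite ?rmorph0.
elim/big_ind: _ => // x y Tx Ty.
rewrite (_ : x + y = x - (0 - y)); last by rewrite sub0r opprK.
by apply: (TB) => //; apply: TB.
Qed.

Lemma overring_sub_colon T I : is_overring T -> T `<=` colon T (ideal_ext I T).
Proof.
move=> oT x Tx _ [n [a [t [_ Tt ->]]]].
have /is_overringP[RT _ TM] := oT.
apply: (TM) => //; apply: overring_sum => // i.
by apply: (TM) => //; apply: RT; apply: base_ring_tofrac.
Qed.

Lemma ideal_inv_gen (n : nat) (a : 'I_n -> R) x :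
  (forall i, base_ring R (x * tofrac (a i))) ->
  ideal_inv [set y | exists c : 'I_n -> R, y = \sum_(i < n) c i * a i] x.
Proof.
move=> xa _ [_ [c ->] <-]; rewrite rmorph_sum mulr_sumr.
apply: overring_sum => [|i].
  by apply/is_overringP; split; [| exact: base_ringB | exact: base_ringM].
by rewrite rmorphM mulrCA /=; apply: base_ringM => //; apply: base_ring_tofrac.
Qed.

Lemma fg_ideal_gen (n : nat) (a : 'I_n -> R) i :
  exists c : 'I_n -> R, a i = \sum_(j < n) c j * a j.
Proof.
exists (fun j => (j == i)%:R).
rewrite (bigD1 i) //= eqxx mul1r big1 ?addr0 // => j /negPf ->.
by rewrite mul0r.
Qed.

(* For [f = 0] this is the whole quotient field. *)
Definition loc f : set {fraction R} :=
  [set x | exists n, base_ring R (tofrac f ^+ n * x)].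

Lemma loc_raise f x (n m : nat) : (n <= m)%N ->
  base_ring R (tofrac f ^+ n * x) -> base_ring R (tofrac f ^+ m * x).
Proof.
move=> nm Rx; rewrite -(subnK nm) exprD -mulrA; apply: base_ringM => //.
by rewrite -rmorphXn; apply: base_ring_tofrac.
Qed.

Lemma loc_overring f : is_overring (loc f).
Proof.
apply/is_overringP; split.
- by move=> x Rx; exists 0%N; rewrite expr0 mul1r.
- move=> x y [n xn] [m ym]; exists (maxn n m); rewrite mulrBr.
  apply: base_ringB; first exact: loc_raise (leq_maxl _ _) xn.
  exact: loc_raise (leq_maxr _ _) ym.
- move=> x y [n xn] [m ym]; exists (n + m)%N.
  by rewrite exprD mulrACA; apply: base_ringM.
Qed.

(** As the generators are finitely many, one power of [f] clears the denominators of all the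
    products [x * a i]; that power times [x] then lies in [I^-1 = R]. *)
Lemma loc_t_linked f : t_linked (loc f).
Proof.
move=> I [n [a ->]] IR; apply/seteqP; split; last first.
  exact: overring_sub_colon (loc_overring f).
move=> x xI.
have /choice[e He] : forall i, exists k, base_ring R (tofrac f ^+ k * (x * tofrac (a i))).
  move=> i; apply: xI; exists 1%N, (fun=> a i), (fun=> 1); split.
  - by move=> _; apply: fg_ideal_gen.
  - by move=> _; exists 0%N; rewrite mulr1; exists 1; rewrite ?rmorph1.
  - by rewrite big_ord1 mulr1.
exists (\max_i e i)%N; rewrite -IR; apply: ideal_inv_gen => i.
by rewrite -mulrA; apply: loc_raise (He i); apply: leq_bigmax.
Qed.

Lemma in_radical_loc f g : in_radical f g -> loc f `<=` loc g.
Proof.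
move=> [n [h gnE]] x [m fx]; exists (n * m)%N.
rewrite exprM -rmorphXn gnE rmorphM mulrC exprMn mulrCA mulrC mulrAC [x * _]mulrC.
by apply: base_ringM => //; rewrite -rmorphXn; apply: base_ring_tofrac.
Qed.

(** The inverse of [f] lies in [loc f], hence in [loc g], so [f] divides a power of [g]. *)
Lemma loc_in_radical f g : f != 0 -> loc f `<=` loc g -> in_radical f g.
Proof.
move=> f0 fg; have tf0 : tofrac f != 0 by rewrite tofrac_eq0.
have [] := fg (tofrac f)^-1.
  by exists 1%N; rewrite expr1 mulfV //; exists 1; rewrite ?rmorph1.
move=> n [h _ hE]; exists n, h; apply/eqP; rewrite -tofrac_eq; apply/eqP.
by rewrite rmorphM /= hE rmorphXn /= mulrCA mulfV // mulr1.
Qed.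

(** * Ideals and overrings when [t_linked_overrings R] is finite *)

Lemma ideal_radical_principal I (Ot_finite : finite_set (t_linked_overrings R))
    (ID : forall a b, I a -> I b -> I (a + b)) (IM : forall a b, I b -> I (a * b)) :
    (exists2 a, I a & a != 0) ->
  exists f, [/\ f != 0, I f & forall a, I a -> in_radical f a].
Proof.
move=> [a0 Ia0 a00].
have [mu [N [muN mu_le mu_eq]]] := finite_set_rank Ot_finite
  (fun f => conj (loc_overring f) (@loc_t_linked f)).
have [] := @ex_nat_min R (fun f => I f /\ f != 0) mu; first by exists a0.
move=> f [If f0] fmin; exists f; split=> //.
apply: contrapT => /existsNP[a /not_implyP[Ia aNf]].
have [] := @ex_nat_max R (fun c => I c /\ ~ in_radical f c) mu N muN.
  by exists a.
move=> c [Ic cNf] cmax; pose g := f + c; apply: (cNf).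
(* Modulo [f], [c * g] is the square of [c], and a radical containing that square contains [c]. *)
have cgNf : ~ in_radical f (c * g).
  move=> /(@in_radicalD _ _ _ (- c)); rewrite mulrN mulrDr [f * c]mulrC addrAC subrr add0r.
  by move=> [n [h E]]; apply: cNf; exists (n + n)%N, h; rewrite exprD -exprMn.
have c_loc : loc c `<=` loc (c * g) by apply: in_radical_loc; exists 1%N, g.
(* Zero lies in every radical. Nonvanishing is needed to invert [c * g] below, and for [g] to
   compete with [f] in the minimal choice. *)
have cg0 : c * g != 0.
  by apply/eqP => cg0; apply: cgNf; exists 1%N, 0; rewrite cg0 mulr0.
have g0 : g != 0 by move: cg0; rewrite mulf_eq0 negb_or => /andP[].
have Ig : I g by apply: ID.
(* [loc c] is contained in [loc (c * g)], so maximality of [mu c] forces equality. *)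
have [n [h cE]] : in_radical (c * g) c.
  apply: loc_in_radical => //; apply: mu_eq => //.
  by apply: cmax; split=> //; apply: IM.
have g_f : in_radical g f.
  have -> : f = - c + g * 1 by rewrite mulr1 /g addrC addrK.
  by apply/in_radicalD/in_radicalN; exists n, (c * h); rewrite cE mulrCA mulrA.
(* Now [loc g] is contained in [loc f], and minimality of [mu f] gives the reverse inclusion.
   Subtracting [f] from [g] then recovers [c]. *)
have : in_radical f g.
  apply: loc_in_radical => //; apply: mu_eq; first exact: in_radical_loc.
  exact: fmin.
by move=> /(@in_radicalD _ _ _ (- 1)); rewrite mulrN1 /g addrAC subrr add0r.
Qed.

(** The first hypothesis says that the inverse of the ideal generated by the [a i] is contained in
    R. Each [x * a i] needs one power of [a i] less than [x], so induction on a bound for the total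
    exponent puts all of them in R, and then [x] too. *)
Lemma base_ring_powers (n : nat) (a : 'I_n -> R) (e : 'I_n -> nat) x :
    (forall y, (forall i, base_ring R (y * tofrac (a i))) -> base_ring R y) ->
    (forall i, base_ring R (x * tofrac (a i) ^+ e i)) ->
  base_ring R x.
Proof.
move=> Ra; have [s es] : exists s, (\sum_i e i <= s)%N by exists (\sum_i e i)%N.
elim: s => [|s IHs] in e es x *; move=> xe; apply: Ra => i.
  move: es; rewrite leqn0 sum_nat_eq0 => /forallP/(_ i)/eqP ei.
  apply: base_ringM (base_ring_tofrac _).
  by have := xe i; rewrite ei expr0 mulr1.
(* A zero exponent already puts [x] in R; only a positive one can be lowered. *)
have [ei|ei] := eqVneq (e i) 0%N.
  apply: base_ringM (base_ring_tofrac _).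
  by have := xe i; rewrite ei expr0 mulr1.
apply: (IHs (fun j => if j == i then (e i).-1 else e j)).
  rewrite -ltnS (leq_trans _ es) // (bigD1 i) //= [X in (_ < X)%N](bigD1 i) //= eqxx.
  rewrite -addSn prednK ?lt0n // leq_add2l.
  by apply: leq_sum => j /negPf ->.
move=> j; case: eqP => [->|_].
  by rewrite -mulrA -exprS prednK ?lt0n.
by rewrite mulrAC; apply: base_ringM (base_ring_tofrac _).
Qed.

Lemma fg_ideal_inv_trivial I (Ot_finite : finite_set (t_linked_overrings R)) :
    fg_ideal I -> ideal_inv I = base_ring R -> (exists2 a, I a & a != 0) -> I 1.
Proof.
move=> [n [a ->]] IR Inz.
have [||f [f0 If frad]] := ideal_radical_principal Ot_finite _ _ Inz.
- move=> _ _ [c ->] [d ->]; exists (fun i => c i + d i).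
  by rewrite -big_split; apply: eq_bigr => i _; rewrite mulrDl.
- move=> b _ [c ->]; exists (fun i => b * c i).
  by rewrite mulr_sumr; apply: eq_bigr => i _; rewrite mulrA.
have tf0 : tofrac f != 0 by rewrite tofrac_eq0.
have /choice[e He] : forall i, exists k, exists h, a i ^+ k = f * h.
  by move=> i; apply: frad; apply: fg_ideal_gen.
(* Each [a i ^+ e i] is a multiple of [f], so the inverse of [f] multiplies it into R. *)
have [h _ hE] : base_ring R (tofrac f)^-1.
  apply: (@base_ring_powers n a e).
    by move=> y ya; rewrite -IR; apply: ideal_inv_gen.
  move=> i; have [h hE] := He i; rewrite -rmorphXn hE rmorphM mulKf //.
  exact: base_ring_tofrac.
have hf1 : h * f = 1.
  by apply/eqP; rewrite -tofrac_eq rmorphM /= hE mulVf // rmorph1.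
move: If => [c fE]; exists (fun i => h * c i); rewrite -hf1 fE mulr_sumr.
by apply: eq_bigr => i _; rewrite mulrA.
Qed.

Lemma overring_t_linked T (Ot_finite : finite_set (t_linked_overrings R)) :
  is_overring T -> t_linked T.
Proof.
move=> oT I fgI IR; apply/seteqP; split; last exact: overring_sub_colon.
have /is_overringP[RT _ _] := oT.
have T1 : T 1 by apply: RT; exists 1; rewrite ?rmorph1.
(* A nonzero [I] contains 1, hence so does its extension to [T], and [x = x * 1] lies in [T]. *)
move=> x xI; have [Inz|I0] := pselect (exists2 a, I a & a != 0).
  rewrite -[x]mulr1; apply: xI; exists 1%N, (fun=> 1), (fun=> 1); split=> //.
    by move=> _; apply: fg_ideal_inv_trivial.
  by rewrite big_ord1 rmorph1 mulr1.
(* If I = 0 then R = I^-1 is the whole quotient field. *)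
apply: RT; rewrite -IR => _ [a Ia <-].
have -> : a = 0 by apply: contrapT => /eqP a0; apply: I0; exists a.
by exists 0; rewrite ?rmorph0 ?mulr0.
Qed.

End Overrings.

Theorem proposition2p1 (R : idomainType)
    (R_not_field : ~ GRing.field_axiom R)
    (Ot_finite : finite_set (t_linked_overrings R)) :
  overrings R = t_linked_overrings R /\ FO_domain R.
Proof.
suff OE : overrings R = t_linked_overrings R by rewrite /FO_domain OE.
apply/seteqP; split=> [T oT|T []//].
by split=> //; apply: overring_t_linked.
Qed.
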